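(* Let $ABCD$ be a tetrahedron of general form in Euclidean space $\mathbb{R}^3$, i.e. one which has exactly eight tangent spheres (spheres tangent to all four planes containing its faces). Then there exist four circular cones each of which is tangent to all eight tangent spheres of the tetrahedron.
   Context: A tangent sphere of a tetrahedron is a sphere tangent to the four planes containing its faces. A tetrahedron of general form has eight of them: the inscribed sphere, four exscribed spheres, and three doubly-exscribed (''roof'') spheres. A circular cone means a (two-sided) right circular cone, i.e. the union of all lines through a point (the vertex) making a fixed angle with a fixed line through that point (the axis). A cone is tangent to a sphere if they have a common point, different from the vertex of the cone, at which their tangent planes coincide. *)

(* Defs.v *)
From HB Require Import structures.
From mathcomp Require Import all_boot all_order all_algebra.
From mathcomp Require Import all_classical all_reals all_analysis.

Set Implicit Arguments.
Unset Strict Implicit.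
Unset Printing Implicit Defensive.

Import Order.TTheory GRing.Theory Num.Theory.
Import numFieldNormedType.Exports.

Local Open Scope classical_set_scope.
Local Open Scope ring_scope.

(* The library norm on 'rV[R]_3 is the sup norm, so the Euclidean structure is
   introduced explicitly. The sup norm is used only through the topology. *)
Definition dot (R : realType) (u v : 'rV[R]_3) : R :=
  \sum_(i < 3) u ord0 i * v ord0 i.

Definition enorm (R : realType) (u : 'rV[R]_3) : R := Num.sqrt (dot u u).

Definition line (R : realType) (p w : 'rV[R]_3) : set 'rV[R]_3 :=
  [set x | exists t : R, x = p + t *: w].

(* Angle, in [0, pi/2], between two unoriented lines with the given (nonzero)
   direction vectors. *)
Definition line_angle (R : realType) (u w : 'rV[R]_3) : R :=
  acos (`|dot u w| / (enorm u * enorm w)).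

Definition plane3 (R : realType) (A B C : 'rV[R]_3) : set 'rV[R]_3 :=
  [set x | exists s t : R, x = A + s *: (B - A) + t *: (C - A)].

Definition sphere (R : realType) (c : 'rV[R]_3) (r : R) : set 'rV[R]_3 :=
  [set x | enorm (x - c) = r].

Definition is_sphere (R : realType) (S : set 'rV[R]_3) : Prop :=
  exists (c : 'rV[R]_3) (r : R), 0 < r /\ S = sphere c r.

Definition sphere_tangent_to_plane (R : realType) (S P : set 'rV[R]_3) : Prop :=
  exists p : 'rV[R]_3, S `&` P = [set p].

Definition nondegenerate_tetrahedron (R : realType) (A B C D : 'rV[R]_3) : Prop :=
  free [:: B - A; C - A; D - A].

(* Spheres are counted as point sets. *)
Definition tangent_spheres (R : realType) (A B C D : 'rV[R]_3) :
    set (set 'rV[R]_3) :=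
  [set S | is_sphere S /\
           [/\ sphere_tangent_to_plane S (plane3 B C D),
               sphere_tangent_to_plane S (plane3 A C D),
               sphere_tangent_to_plane S (plane3 A B D) &
               sphere_tangent_to_plane S (plane3 A B C)]].

Definition general_form (R : realType) (A B C D : 'rV[R]_3) : Prop :=
  nondegenerate_tetrahedron A B C D /\ (tangent_spheres A B C D #= `I_8)%card.

(* The bounds on the angle exclude a single line (angle 0) and a plane
   (angle pi/2). *)
Record circular_cone (R : realType) := CircularCone {
  cone_vertex : 'rV[R]_3;
  cone_axis : 'rV[R]_3;
  cone_angle : R;
  cone_axis_neq0 : cone_axis != 0;
  cone_angle_bounds : 0 < cone_angle < pi / 2
}.

Definition cone_points (R : realType) (K : circular_cone R) : set 'rV[R]_3 :=
  \bigcup_(w in [set w : 'rV[R]_3 |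
                  w != 0 /\ line_angle (cone_axis K) w = cone_angle K])
    line (cone_vertex K) w.

(* The affine set of all p + g'(0), where g is a curve in S with g(0) = p that
   is differentiable at 0; this is the usual tangent plane when S is a smooth
   surface near p, as are a sphere, and a cone away from its vertex. *)
Definition tangent_plane (R : realType) (S : set 'rV[R]_3) (p : 'rV[R]_3) :
    set 'rV[R]_3 :=
  [set x | exists g : R -> 'rV[R]_3,
     [/\ g 0 = p, \forall t \near (0 : R), S (g t) &
         is_derive (0 : R) (1 : R) g (x - p)]].

Definition cone_tangent_to_sphere (R : realType) (K : circular_cone R)
    (S : set 'rV[R]_3) : Prop :=
  exists p : 'rV[R]_3,
    [/\ cone_points K p, S p, p <> cone_vertex K &
        tangent_plane (cone_points K) p = tangent_plane S p].

(* Main.v *)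
Require Import Defs.
From mathcomp Require Import all_boot all_order all_algebra.
From mathcomp Require Import all_classical all_reals all_analysis.
From mathcomp Require Import ring lra.

(** Each cone has its apex at a vertex [P] of the tetrahedron. The spheres tangent
    to the three faces through [P] are, up to a dilation centred at [P], the four
    inscribed spheres of the trihedral angle at [P] and their reflections in [P];
    seen from [P] they are the incircle and the three excircles of a spherical
    triangle. By Hart's theorem (the spherical Feuerbach theorem) there is a
    circle tangent to these four circles; the cone over it is the required one.

    If [n1], [n2], [n3] are the unit normals of the faces at [P] and
    [u := (c - P) / r] for a tangent sphere of centre [c] and radius [r], then
    [dot n_i u] is 1 or -1. The axis [w] of Hart's cone is determined by
    [dot n1 w = cos (B - C)], [dot n2 w = cos (A - C)], [dot n3 w = cos (A - B)],
    where [A], [B], [C] are the dihedral angles at [P]; with this normalization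
    the sine of its half-angle is [1 / |w|], and the cone is tangent to the sphere
    if and only if [(|u|^2 - 1) (|w|^2 - 1) = (e * dot u w - 1)^2] for a sign [e],
    namely the product of the three signs [dot n_i u]. *)

Set Implicit Arguments.
Unset Strict Implicit.
Unset Printing Implicit Defensive.

Import Order.TTheory GRing.Theory Num.Theory.
Import numFieldNormedType.Exports.

Local Open Scope classical_set_scope.
Local Open Scope ring_scope.

(** * Inner, cross and triple products in three-dimensional space *)

Section Dot.
Variable R : realType.
Implicit Types (u v w x : 'rV[R]_3) (a : R).

Lemma dotE u v : dot u v =
  u ord0 0 * v ord0 0 + u ord0 1 * v ord0 1 + u ord0 2 * v ord0 2.
Proof.
rewrite /dot !big_ord_recl big_ord0 addr0 addrA.
by congr (_ + _ * _ + _ * _); congr (_ _ _); apply: val_inj.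
Qed.

Lemma row3P u v : u ord0 0 = v ord0 0 -> u ord0 1 = v ord0 1 ->
  u ord0 2 = v ord0 2 -> u = v.
Proof.
move=> h0 h1 h2; apply/rowP => -[[|[|[|//]]] ilt].
- by rewrite (_ : Ordinal _ = 0) //; apply: val_inj.
- by rewrite (_ : Ordinal _ = 1) //; apply: val_inj.
- by rewrite (_ : Ordinal _ = 2) //; apply: val_inj.
Qed.

Lemma dotC u v : dot u v = dot v u.
Proof. by rewrite !dotE; ring. Qed.

Lemma dotDl u v w : dot (u + v) w = dot u w + dot v w.
Proof. by rewrite !dotE !mxE; ring. Qed.

Lemma dotDr u v w : dot w (u + v) = dot w u + dot w v.
Proof. by rewrite dotC dotDl !(dotC w). Qed.

Lemma dotZl a u w : dot (a *: u) w = a * dot u w.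
Proof. by rewrite !dotE !mxE; ring. Qed.

Lemma dotZr a u w : dot w (a *: u) = a * dot w u.
Proof. by rewrite dotC dotZl dotC. Qed.

Lemma dotNl u w : dot (- u) w = - dot u w.
Proof. by rewrite -scaleN1r dotZl mulN1r. Qed.

Lemma dotNr u w : dot w (- u) = - dot w u.
Proof. by rewrite dotC dotNl dotC. Qed.

Lemma dot0r w : dot w 0 = 0.
Proof. by rewrite -(scale0r 0) dotZr mul0r. Qed.

Definition dot_lin := (dotDl, dotDr, dotNl, dotNr, dotZl, dotZr).

Lemma dot_ge0 u : 0 <= dot u u.
Proof. by rewrite dotE !addr_ge0 // -expr2 sqr_ge0. Qed.

Lemma dot_eq0 u : (dot u u == 0) = (u == 0).
Proof.
apply/eqP/eqP => [|->]; last exact: dot0r.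
rewrite dotE -!expr2 => h.
have h0 := sqr_ge0 (u ord0 0); have h1 := sqr_ge0 (u ord0 1).
have h2 := sqr_ge0 (u ord0 2).
by apply: row3P; rewrite mxE; apply/eqP; rewrite -sqrf_eq0; apply/eqP; lra.
Qed.

Lemma dot_gt0 u : (0 < dot u u) = (u != 0).
Proof. by rewrite lt_def dot_ge0 andbT dot_eq0. Qed.

Lemma dot_CauchySchwarz u v : dot u v ^+ 2 <= dot u u * dot v v.
Proof.
have [->|v0] := eqVneq v 0; first by rewrite !dot0r mulr0 expr2 mulr0.
have := dot_ge0 (dot v v *: u - dot u v *: v).
rewrite !dot_lin (dotC v u) => h.
have v_gt0 : 0 < dot v v by rewrite dot_gt0.
rewrite -subr_ge0 -(pmulr_rge0 _ v_gt0); apply: le_trans h _.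
by rewrite le_eqVlt; apply/orP; left; apply/eqP; ring.
Qed.

Lemma enorm_sqr u : enorm u ^+ 2 = dot u u.
Proof. by rewrite sqr_sqrtr // dot_ge0. Qed.

Lemma enorm_gt0 u : (0 < enorm u) = (u != 0).
Proof. by rewrite sqrtr_gt0 dot_gt0. Qed.

Lemma sphereE c (r : R) : 0 < r ->
  sphere c r = [set x | dot (x - c) (x - c) = r ^+ 2].
Proof.
move=> r0; apply/seteqP; split => x /=; rewrite /sphere /=.
  by move=> <-; rewrite enorm_sqr.
by rewrite /enorm => ->; rewrite sqrtr_sqr gtr0_norm.
Qed.

Definition cross u v : 'rV[R]_3 := \row_j
  if j == 0 then u ord0 1 * v ord0 2 - u ord0 2 * v ord0 1
  else if j == 1 then u ord0 2 * v ord0 0 - u ord0 0 * v ord0 2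
  else u ord0 0 * v ord0 1 - u ord0 1 * v ord0 0.

Lemma crossE u v :
  (cross u v ord0 0 = u ord0 1 * v ord0 2 - u ord0 2 * v ord0 1) *
  (cross u v ord0 1 = u ord0 2 * v ord0 0 - u ord0 0 * v ord0 2) *
  (cross u v ord0 2 = u ord0 0 * v ord0 1 - u ord0 1 * v ord0 0).
Proof. by rewrite !mxE. Qed.

Definition trip u v w := dot u (cross v w).

Lemma tripE u v w : trip u v w =
  u ord0 0 * (v ord0 1 * w ord0 2 - v ord0 2 * w ord0 1) +
  u ord0 1 * (v ord0 2 * w ord0 0 - v ord0 0 * w ord0 2) +
  u ord0 2 * (v ord0 0 * w ord0 1 - v ord0 1 * w ord0 0).
Proof. by rewrite /trip dotE !crossE. Qed.

(** Cramer's rule for the coordinates of [x] with respect to [u], [v], [w]. *)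
Lemma trip_decomp u v w x : trip u v w *: x =
  dot x (cross v w) *: u + dot x (cross w u) *: v + dot x (cross u v) *: w.
Proof.
by apply: row3P; rewrite !mxE tripE !dotE !crossE; ring.
Qed.

Lemma trip_cross u v w :
  trip (cross v w) (cross w u) (cross u v) = trip u v w ^+ 2.
Proof. by rewrite !tripE !crossE; ring. Qed.

Lemma trip_scale (a b c : R) u v w :
  trip (a *: u) (b *: v) (c *: w) = a * b * c * trip u v w.
Proof. by rewrite !tripE !mxE; ring. Qed.

Lemma trip_gram u v w : trip u v w ^+ 2 =
  dot u u * dot v v * dot w w + 2 * dot u v * dot u w * dot v w
  - dot u u * dot v w ^+ 2 - dot v v * dot u w ^+ 2 - dot w w * dot u v ^+ 2.
Proof. by rewrite tripE !dotE; ring. Qed.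

(* The Gram determinant of four vectors of a 3-dimensional space vanishes. *)
Lemma gram4_eq0 u v w x : trip u v w ^+ 2 * dot x x =
    (dot v v * dot w w - dot v w ^+ 2) * dot u x ^+ 2
  + (dot u u * dot w w - dot u w ^+ 2) * dot v x ^+ 2
  + (dot u u * dot v v - dot u v ^+ 2) * dot w x ^+ 2
  + 2 * (dot u w * dot v w - dot u v * dot w w) * dot u x * dot v x
  + 2 * (dot u v * dot v w - dot u w * dot v v) * dot u x * dot w x
  + 2 * (dot u v * dot u w - dot v w * dot u u) * dot v x * dot w x.
Proof. by rewrite tripE !dotE; ring. Qed.

Lemma free3P u v w : free [:: u; v; w] ->
  forall a b c : R, a *: u + b *: v + c *: w = 0 -> [/\ a = 0, b = 0 & c = 0].
Proof.
move=> fr a b c e.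
have /(_ (fun i : 'I_3 => [:: a; b; c]`_i)) H := elimT (@freeP _ _ _ [tuple u; v; w]) fr.
have {}H : forall i : 'I_3, [:: a; b; c]`_i = 0.
  by apply: H; rewrite !big_ord_recl big_ord0 /= addr0 addrA.
by split; [exact: (H 0) | exact: (H 1) | exact: (H 2)].
Qed.

(** If the triple product vanished, Cramer's rule would become a linear relation, so [cross u v]
    would be orthogonal to every [x], hence zero; expanding [cross v (cross u v)] then forces
    [v = 0]. *)
Lemma free_trip u v w : free [:: u; v; w] -> trip u v w != 0.
Proof.
move=> /free3P fr; apply/eqP => t0.
have dep x : dot x (cross u v) = 0.
  by have := trip_decomp u v w x; rewrite t0 scale0r => /esym/fr[].
have uv0 : cross u v = 0 by apply/eqP; rewrite -dot_eq0 dep.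
have e : dot v v *: u + (- dot u v) *: v + 0 *: w = cross v (cross u v).
  by apply: row3P; rewrite !crossE !mxE !dotE; ring.
have c0 x : cross x 0 = 0 by apply: row3P; rewrite !crossE !mxE; ring.
have [/eqP v0 _ _] := fr _ _ _ (etrans e (etrans (congr1 _ uv0) (c0 v))).
rewrite dot_eq0 in v0.
have /fr[_ /eqP] : 0 *: u + 1 *: v + 0 *: w = 0.
  by rewrite (eqP v0) !scale0r scaler0 !addr0.
by rewrite oner_eq0.
Qed.

Lemma exists_orthogonal w : exists2 e, e != 0 & dot e w = 0.
Proof.
have [/andP[/eqP w0 /eqP w1]|nz] := boolP ((w ord0 0 == 0) && (w ord0 1 == 0)).
  exists (delta_mx ord0 0); last by rewrite dotE !mxE w0 w1 /=; ring.
  by apply/eqP => /rowP/(_ 0); rewrite !mxE /= => /eqP; rewrite oner_eq0.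
exists (\row_j if j == 0 then w ord0 1 else if j == 1 then - w ord0 0 else 0).
  apply: contraNneq nz => /rowP h.
  have := h 0; have := h 1; rewrite !mxE /= => /eqP.
  by rewrite oppr_eq0 => /eqP -> ->; rewrite !eqxx.
by rewrite dotE !mxE /=; ring.
Qed.

End Dot.

(** * Hart's theorem for spherical triangles, in vector form *)

Section Hart.
Variable R : realType.
Implicit Types (n u w : 'rV[R]_3).

Section Scalars.
Variables c1 c2 c3 s1 s2 s3 : R.
Hypotheses (h1 : s1 ^+ 2 = 1 - c1 ^+ 2) (h2 : s2 ^+ 2 = 1 - c2 ^+ 2)
           (h3 : s3 ^+ 2 = 1 - c3 ^+ 2).

(* For a spherical triangle with angles [A], [B], [C] of cosines [c1], [c2],
   [c3] and sines [s1], [s2], [s3], [hart_gram] is the Gram determinant of the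
   inner unit normals of the sides, [hart_q] is [1 + cos (A + B + C)],
   [hart_v1] is [cos (B - C)], and [hart_w1], [hart_w2], [hart_w3] are
   [hart_gram] times the coordinates in the basis of the normals of the vector
   whose inner products with the normals are [hart_v1], [hart_v2],
   [hart_v3]. *)
Definition hart_gram : R :=
  1 - c1 ^+ 2 - c2 ^+ 2 - c3 ^+ 2 - 2 * c1 * c2 * c3.
Definition hart_q : R :=
  1 + c1 * c2 * c3 - c1 * s2 * s3 - s1 * c2 * s3 - s1 * s2 * c3.
Definition hart_v1 : R := c2 * c3 + s2 * s3.
Definition hart_v2 : R := c1 * c3 + s1 * s3.
Definition hart_v3 : R := c1 * c2 + s1 * s2.
Definition hart_w1 : R := (1 - c1 ^+ 2) * hart_v1
  + (c1 * c2 + c3) * hart_v2 + (c1 * c3 + c2) * hart_v3.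
Definition hart_w2 : R := (1 - c2 ^+ 2) * hart_v2
  + (c1 * c2 + c3) * hart_v1 + (c2 * c3 + c1) * hart_v3.
Definition hart_w3 : R := (1 - c3 ^+ 2) * hart_v3
  + (c1 * c3 + c2) * hart_v1 + (c2 * c3 + c1) * hart_v2.

(** [hart_q - 1] is cos (A + B + C) and the squared bracket is sin (A + B + C), so the bound says
    that a cosine is at least -1. *)
Lemma hart_q_ge0 : 0 <= hart_q.
Proof.
have : (hart_q - 1) ^+ 2 = 1 -
    (s1 * c2 * c3 + c1 * s2 * c3 + c1 * c2 * s3 - s1 * s2 * s3) ^+ 2.
  by rewrite /hart_q; ring: h1 h2 h3.
have := sqr_ge0 (s1 * c2 * c3 + c1 * s2 * c3 + c1 * c2 * s3 - s1 * s2 * s3).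
move=> sin_ge0 cosE; rewrite leNgt; apply/negP => q_lt0.
have : hart_q * (hart_q - 2) <= 0 by lra.
by rewrite nmulr_rle0 //; lra.
Qed.

(** For the axis [w] of Hart's cone the bracket equals [hart_gram * (dot w w - 1)]; the identity
    thus yields [hart_q * (dot w w - 1) = 2 * hart_gram]. *)
Lemma hart_norm_id :
  hart_q * (hart_v1 * hart_w1 + hart_v2 * hart_w2 + hart_v3 * hart_w3
            - hart_gram) = 2 * hart_gram ^+ 2.
Proof.
rewrite /hart_w1 /hart_w2 /hart_w3 /hart_v1 /hart_v2 /hart_v3.
rewrite /hart_q /hart_gram.
by ring: h1 h2 h3.
Qed.

(** The [ei] stand for the signs [dot n_i u]. The left bracket is then [hart_gram * (dot u u - 1)]
    and the squared one [hart_gram * (e * dot u w - 1)] with [e = e1 * e2 * e3], so after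
    [hart_norm_id] this is the tangency condition up to a factor. *)
Lemma hart_tangency_id (e1 e2 e3 : R) :
  e1 ^+ 2 = 1 -> e2 ^+ 2 = 1 -> e3 ^+ 2 = 1 ->
  2 * hart_gram ^+ 2 * ((1 - c1 ^+ 2) + (1 - c2 ^+ 2) + (1 - c3 ^+ 2)
     + 2 * e1 * e2 * (c1 * c2 + c3) + 2 * e1 * e3 * (c1 * c3 + c2)
     + 2 * e2 * e3 * (c2 * c3 + c1) - hart_gram)
  = hart_q * (e1 * e2 * e3 * (e1 * hart_w1 + e2 * hart_w2 + e3 * hart_w3)
              - hart_gram) ^+ 2.
Proof.
move=> h4 h5 h6.
rewrite /hart_w1 /hart_w2 /hart_w3 /hart_v1 /hart_v2 /hart_v3.
rewrite /hart_q /hart_gram.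
by ring: h1 h2 h3 h4 h5 h6.
Qed.

End Scalars.

Lemma dot_subZ n u : dot n n = 1 -> dot n u ^+ 2 = 1 ->
  dot (u - dot n u *: n) (u - dot n u *: n) = dot u u - 1.
Proof. by move=> n1 u1; rewrite !dot_lin n1 (dotC u n); ring: u1. Qed.

(* The point [u] is the centre of a unit sphere tangent to the planes through the
   origin with normals [n1] and [n2]; if its norm were 1, the sphere would pass
   through the origin, and the two planes would coincide. *)
Lemma tangent_center_norm n1 n2 n3 u :
  dot n1 n1 = 1 -> dot n2 n2 = 1 -> trip n1 n2 n3 != 0 ->
  dot n1 u ^+ 2 = 1 -> dot n2 u ^+ 2 = 1 -> 1 < dot u u.
Proof.
move=> n11 n22 tn u1 u2; rewrite lt_neqAle -subr_ge0.
rewrite -(dot_subZ n11 u1) dot_ge0 andbT.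
apply: contraNneq tn => uu.
have prop n : dot n n = 1 -> dot n u ^+ 2 = 1 -> n = dot n u *: u.
  move=> nn nu; have /eqP : dot (u - dot n u *: n) (u - dot n u *: n) = 0.
    by rewrite dot_subZ // -uu subrr.
  by rewrite dot_eq0 subr_eq0 => /eqP uE; rewrite {2}uE scalerA -expr2 nu scale1r.
rewrite (prop _ n11 u1) (prop _ n22 u2) -(scale1r n3) trip_scale tripE.
by apply/eqP; ring.
Qed.

Lemma hart_circle n1 n2 n3 :
  dot n1 n1 = 1 -> dot n2 n2 = 1 -> dot n3 n3 = 1 -> trip n1 n2 n3 != 0 ->
  exists2 w, 1 < dot w w &
    forall u, dot n1 u ^+ 2 = 1 -> dot n2 u ^+ 2 = 1 -> dot n3 u ^+ 2 = 1 ->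
    exists e : R, [/\ e ^+ 2 = 1, 1 < dot u u &
      (dot u u - 1) * (dot w w - 1) = (e * dot u w - 1) ^+ 2].
Proof.
move=> n11 n22 n33 tn.
(* The interior angle between two faces is the supplement of the angle between their inner
   normals. *)
pose c1 := - dot n2 n3; pose c2 := - dot n1 n3; pose c3 := - dot n1 n2.
have sinP n m : dot n n = 1 -> dot m m = 1 ->
    Num.sqrt (1 - (- dot n m) ^+ 2) ^+ 2 = 1 - (- dot n m) ^+ 2.
  move=> nn mm; rewrite sqr_sqrtr // sqrrN subr_ge0.
  by rewrite (le_trans (dot_CauchySchwarz _ _)) // nn mm mulr1.
have := sinP _ _ n22 n33; have := sinP _ _ n11 n33; have := sinP _ _ n11 n22.
rewrite -/c1 -/c2 -/c3.
move: (Num.sqrt _) (Num.sqrt _) (Num.sqrt _) => s1 s2 s3 h3 h2 h1.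
pose D := hart_gram c1 c2 c3.
have tripD : trip n1 n2 n3 ^+ 2 = D.
  by rewrite trip_gram n11 n22 n33 /D /hart_gram /c1 /c2 /c3; ring.
have D_gt0 : 0 < D by rewrite -tripD lt_def sqr_ge0 sqrf_eq0 tn.
have D0 : D != 0 by rewrite gt_eqF.
set q := hart_q c1 c2 c3 s1 s2 s3.
have := hart_norm_id h1 h2 h3; have := hart_tangency_id h1 h2 h3.
rewrite -/q -/D.
set v1 := hart_v1 _ _ _ _; set v2 := hart_v2 _ _ _ _; set v3 := hart_v3 _ _ _ _.
set w1 := hart_w1 _ _ _ _ _ _; set w2 := hart_w2 _ _ _ _ _ _.
set w3 := hart_w3 _ _ _ _ _ _ => tangid normid.
pose w := D^-1 *: (w1 *: n1 + w2 *: n2 + w3 *: n3).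
have dotw u : dot u w = D^-1 * (dot n1 u * w1 + dot n2 u * w2 + dot n3 u * w3).
  by rewrite /w !dot_lin !(dotC u); ring.
have c1E : dot n2 n3 = - c1 by rewrite opprK.
have c2E : dot n1 n3 = - c2 by rewrite opprK.
have c3E : dot n1 n2 = - c3 by rewrite opprK.
have n1w : dot n1 w = v1.
  rewrite dotw n11 (dotC n2) (dotC n3) c2E c3E; apply: (mulfI D0).
  rewrite mulVKf // /D /w1 /w2 /w3 /hart_w1 /hart_w2 /hart_w3 /hart_gram.
  by rewrite -/v1 -/v2 -/v3; ring.
have n2w : dot n2 w = v2.
  rewrite dotw n22 (dotC n3) c1E c3E; apply: (mulfI D0).
  rewrite mulVKf // /D /w1 /w2 /w3 /hart_w1 /hart_w2 /hart_w3 /hart_gram.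
  by rewrite -/v1 -/v2 -/v3; ring.
have n3w : dot n3 w = v3.
  rewrite dotw n33 c1E c2E; apply: (mulfI D0).
  rewrite mulVKf // /D /w1 /w2 /w3 /hart_w1 /hart_w2 /hart_w3 /hart_gram.
  by rewrite -/v1 -/v2 -/v3; ring.
have qw : q * (dot w w - 1) = 2 * D.
  apply: (mulfI D0); rewrite dotw n1w n2w n3w.
  by rewrite mulrCA mulrBr mulVKf // mulr1 normid; ring.
have q_gt0 : 0 < q.
  rewrite lt_def hart_q_ge0 // andbT; apply: contra_neq D0 => q0.
  by move: qw; rewrite q0 mul0r => /esym/eqP; rewrite mulf_eq0 pnatr_eq0 /= => /eqP.
exists w.
  by rewrite -subr_gt0 -(pmulr_rgt0 _ q_gt0) qw mulr_gt0.
move=> u u1 u2 u3; exists (dot n1 u * dot n2 u * dot n3 u); split.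
- by rewrite !exprMn u1 u2 u3 !mulr1.
- exact: tangent_center_norm tn u1 u2.
(* The vanishing Gram determinant of [n1], [n2], [n3], [u] expresses the norm of [u] through its
   products with the normals. *)
have uD : D * dot u u = (1 - c1 ^+ 2) + (1 - c2 ^+ 2) + (1 - c3 ^+ 2)
     + 2 * dot n1 u * dot n2 u * (c1 * c2 + c3)
     + 2 * dot n1 u * dot n3 u * (c1 * c3 + c2)
     + 2 * dot n2 u * dot n3 u * (c2 * c3 + c1).
  by rewrite -tripD gram4_eq0 n11 n22 n33 u1 u2 u3 c1E c2E c3E; ring.
have := tangid _ _ _ u1 u2 u3; rewrite -uD => tangu.
apply: (mulfI (lt0r_neq0 q_gt0)); rewrite mulrCA qw.
apply: (mulfI (expf_neq0 2 D0)).
transitivity (2 * D ^+ 2 * (D * dot u u - D)); first by ring.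
rewrite tangu dotw; by field; exact: D0.
Qed.
End Hart.

(** * Tangent planes of quadrics, defined by velocities of curves *)

Section TangentPlane.
Variable R : realType.

Lemma is_derive_quadratic (V : normedModType R) (p v : V) (h : R -> V) :
  {for 0, continuous h} ->
  is_derive (0 : R) (1 : R) (fun t => p + t *: v + t *: (t *: h t)) v.
Proof.
move=> hc.
(* This is the difference quotient in direction 1 with the derivative unfolded; it simplifies to
   [v + t *: h t]. *)
have lim : (fun t : R => t^-1 *: ((p + (t *: (1 : R) + 0) *: v +
    (t *: (1 : R) + 0) *: ((t *: (1 : R) + 0) *: h (t *: (1 : R) + 0)))
    - (p + (0 : R) *: v + (0 : R) *: ((0 : R) *: h 0)))) @ 0^' --> v.
  apply: (@cvg_trans _ ((fun t : R => v + t *: h t) @ 0^')).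
    apply: near_eq_cvg; near=> t.
    have t0 : t != 0 by near: t; exact: nbhs_dnbhs_neq.
    rewrite addr0 -[t *: 1]/(t * 1) mulr1 !scale0r !addr0 -(addrA p).
    by rewrite [_ - p]addrC addKr scalerDr !scalerA mulKf // mulVf // scale1r.
  suff : (fun t : R => v + t *: h t) @ 0^' --> v + 0 *: h 0.
    by rewrite scale0r addr0.
  apply: cvgD; first exact: cvg_cst.
  apply: cvg_within_filter.
  by apply: cvgZ; [exact: cvg_id | exact: hc].
apply: DeriveDef.
  by apply/cvg_ex; exists v; exact: lim.
by apply/cvg_lim => //; exact: lim.
Unshelve. all: by end_near. Qed.

Lemma cvg_dot (T : Type) (F : set_system T) (FF : Filter F)
    (f g : T -> 'rV[R]_3) (a b : 'rV[R]_3) :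
  f @ F --> a -> g @ F --> b -> (fun t => dot (f t) (g t)) @ F --> dot a b.
Proof.
move=> fa gb.
have coord (h : T -> 'rV[R]_3) (c : 'rV[R]_3) i :
    h @ F --> c -> (fun t => h t ord0 i) @ F --> c ord0 i.
  move=> hc; pose pr (M : 'rV[R]_3) := M ord0 i.
  apply: (@continuous_cvg _ 'rV[R]_3 R F FF h pr c) => //.
  exact: coord_continuous.
under eq_fun do rewrite dotE.
by rewrite dotE; apply: cvgD; [apply: cvgD|]; apply: cvgM; exact: coord.
Qed.

(** Spheres and circular cones both have this form around [p], with [n] half the gradient there. The
    vector [z] leads to a second point of [S] off the tangent plane, from which [S] is parametrized
    near [p]. *)
Lemma tangent_plane_quadric (S : set 'rV[R]_3) (p z n w : 'rV[R]_3) (al be : R)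
    (q := fun h k => al * dot h k + be * dot w h * dot w k) :
  (forall h, S (p + h) <-> q h h + 2 * dot n h = 0) ->
  q z z + 2 * dot n z = 0 -> dot n z != 0 ->
  tangent_plane S p = [set x | dot n (x - p) = 0].
Proof.
move=> SE zS nz.
have qzz : q z z = - (2 * dot n z) by apply/eqP; rewrite -addr_eq0 zS.
apply/seteqP; split => x /=.
  case=> g [g0 gS [dg ge]].
  have lim : (fun t : R => t^-1 *: (g t - p)) @ 0^' --> x - p.
    rewrite -ge -{1}g0 /derive.
    under [X in X @ _ --> _]eq_fun => t.
      rewrite -[in g t](addr0 t) -[in g (t + 0)](mulr1 t).
      over.
    exact: dg.
  set D := (fun t : R => t^-1 *: (g t - p)) in lim.
  (* The equation of [S] at [p + t *: D t], divided by [t]; its quadratic term dies in the limit. *)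
  have qlim : (fun t : R => t * q (D t) (D t) + 2 * dot n (D t)) @ 0^' -->
      0 * q (x - p) (x - p) + 2 * dot n (x - p).
    have dn : (fun t => dot n (D t)) @ 0^' --> dot n (x - p).
      by apply: cvg_dot lim; exact: cvg_cst.
    have dw : (fun t => dot w (D t)) @ 0^' --> dot w (x - p).
      by apply: cvg_dot lim; exact: cvg_cst.
    have dd : (fun t => dot (D t) (D t)) @ 0^' --> dot (x - p) (x - p).
      by apply: cvg_dot.
    apply: cvgD; apply: cvgM => //; try exact: cvg_cst.
      by apply: cvg_within_filter; exact: cvg_id.
    by apply: cvgD; do ![apply: cvgM => //]; exact: cvg_cst.
  have q0 : (fun t : R => t * q (D t) (D t) + 2 * dot n (D t)) @ 0^' --> (0 : R).
    apply: (@cvg_trans _ ((fun=> 0 : R) @ (0 : R)^')); last exact: cvg_cst.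
    apply: near_eq_cvg; near=> t.
    have t0 : t != 0 by near: t; exact: nbhs_dnbhs_neq.
    have : S (p + t *: D t).
      rewrite /D scalerA mulfV // scale1r addrC subrK.
      by near: t; apply: nbhs_dnbhs.
    move=> /SE; rewrite /q !dotZl !dotZr => e.
    apply: (mulfI t0); rewrite mulr0 -[LHS]e; ring.
  have e : 0 = 0 * q (x - p) (x - p) + 2 * dot n (x - p).
    exact: cvg_unique q0 qlim.
  by move/esym/eqP: e; rewrite mul0r add0r mulf_eq0 pnatr_eq0 /= => /eqP.
(* Stereographic projection from [p + z]: the second intersection point of [S]
   with the line joining [p + z] to [p + t *: v]. *)
have [v vE] : exists v, v = x - p by exists (x - p).
rewrite -vE => nv.
(* [den t] is [q (t *: v - z) (t *: v - z)], nonzero near 0 because [q z z] is [- (2 * dot n z)]. *)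
pose den t := t ^+ 2 * q v v - 2 * t * q z v + q z z.
pose h t := (- q v v / den t) *: (t *: v - z).
have den0 : den 0 != 0.
  by rewrite /den expr0n /= mulr0 !mul0r subrr add0r qzz oppr_eq0 mulf_neq0 ?pnatr_eq0.
have denc : {for 0, continuous den}.
  rewrite /den; apply: cvgD; last exact: cvg_cst.
  apply: cvgB; apply: cvgM; try exact: cvg_cst.
    by apply: cvgM; exact: cvg_id.
  by apply: cvgM; [exact: cvg_cst | exact: cvg_id].
exists (fun t => p + t *: v + t *: (t *: h t)); split.
- by rewrite !scale0r !addr0.
- near=> t; have dent : den t != 0.
    near: t; apply: (cvgr_neq0 _ denc den0).
  rewrite -addrA; apply/SE; rewrite /h.
  have -> : t *: v + t *: (t *: ((- q v v / den t) *: (t *: v - z))) =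
     (1 - t ^+ 2 * q v v / den t) *: (t *: v - z) + z.
    by apply: row3P; rewrite !mxE; ring.
  have -> : 1 - t ^+ 2 * q v v / den t = (q z z - 2 * t * q z v) / den t.
    by rewrite -{1}(divff dent) -mulrBl /den; congr (_ / _); ring.
  have nz' : dot n z = - q z z / 2 by rewrite qzz; field.
  set m := _ / _.
  (* The root [m = 0] is the centre of projection [p + z]; the chosen [m] kills the other factor. *)
  have -> : q (m *: (t *: v - z) + z) (m *: (t *: v - z) + z) +
      2 * dot n (m *: (t *: v - z) + z) =
      m * (m * den t - (q z z - 2 * t * q z v)).
    by rewrite /den /q !dot_lin nv nz' /q (dotC v z); field.
  by rewrite /m divfK // subrr mulr0.
- apply: is_derive_eq vE; apply: is_derive_quadratic; apply: cvgZ.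
    apply: cvgM; first exact: cvg_cst.
    exact: cvgV.
  apply: cvgB; last exact: cvg_cst.
  by apply: cvgZ; [exact: cvg_id | exact: cvg_cst].
Unshelve. all: by end_near. Qed.

End TangentPlane.

(** * Circular cones as quadrics and their contact with spheres *)

Section Cone.
Variable R : realType.
Implicit Types (V w y x c : 'rV[R]_3) (K : circular_cone R).

Lemma circular_cone_cos_bounds K : 0 < cos (cone_angle K) < 1.
Proof.
have /andP[a0 api] := cone_angle_bounds K.
have pi0 := pi_gt0 R.
rewrite cos_gt0_pihalf /=; last by rewrite api andbT; lra.
by rewrite -[ltRHS]cos0 ltr_cos // in_itv /=; apply/andP; split; lra.
Qed.

Lemma cone_pointsE K : cone_points K = [set x |
  dot (cone_axis K) (x - cone_vertex K) ^+ 2 =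
  cos (cone_angle K) ^+ 2 * dot (cone_axis K) (cone_axis K)
   * dot (x - cone_vertex K) (x - cone_vertex K)].
Proof.
set a := cone_axis K; set V := cone_vertex K; set k := cos _.
have /andP[k0 k1] := circular_cone_cos_bounds K; rewrite -/k in k0 k1.
have a0 : a != 0 := cone_axis_neq0 K.
have /andP[ang0 angpi] := cone_angle_bounds K.
have na := a0; rewrite -enorm_gt0 in na.
have angleP y : y != 0 ->
    line_angle a y = cone_angle K <-> dot a y ^+ 2 = k ^+ 2 * dot a a * dot y y.
  move=> y0; have ny := y0; rewrite -enorm_gt0 in ny.
  have z0 : 0 <= `|dot a y| / (enorm a * enorm y) by rewrite divr_ge0 // mulr_ge0 // ltW.
  have z2 : (`|dot a y| / (enorm a * enorm y)) ^+ 2 = dot a y ^+ 2 / (dot a a * dot y y).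
    by rewrite exprMn exprVn exprMn !enorm_sqr real_normK // num_real.
  have ay0 : dot a a * dot y y != 0 by rewrite mulf_neq0 // dot_eq0.
  split => [e|e].
    have z1 : `|dot a y| / (enorm a * enorm y) <= 1.
      rewrite -(expr_le1 (n := 2)) // z2 ler_pdivrMr ?mul1r ?dot_CauchySchwarz //.
      by rewrite mulr_gt0 // dot_gt0.
    rewrite -mulrA -[LHS](divfK ay0) -z2 /k -e acosK //.
    by rewrite in_itv /= z1 andbT (le_trans _ z0) // lerN10.
  have -> : line_angle a y = acos k.
    congr acos; apply/eqP; rewrite -(eqrXn2 (n := 2)) // ?ltW //.
    by rewrite z2 e -(mulrA (k ^+ 2)) mulfK.
  rewrite cosK // in_itv /= ltW //= (le_trans (ltW angpi)) // ler_pdivrMr //.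
  by rewrite ler_peMr ?pi_ge0 // ler1n.
apply/seteqP; split => x /=.
  case=> y [y0 /(angleP _ y0) ye] [t ->].
  by rewrite addrC addKr !dot_lin exprMn ye; ring.
move=> xe; have [/eqP|y0] := boolP (x - V == 0); last first.
  exists (x - V); first by split => //; exact/angleP.
  by exists 1; rewrite scale1r addrC subrK.
move/eqP; rewrite subr_eq0 => /eqP ->.
(* The vertex belongs to the union only through some generating line, so a direction at the right
   angle to the axis is built from [a] and a vector orthogonal to it. *)
have [e e0 ea] := exists_orthogonal a; rewrite dotC in ea.
pose y := (k * enorm e) *: a + (sin (cone_angle K) * enorm a) *: e.
have yy : dot y y = dot a a * dot e e.
  rewrite /y !dot_lin (dotC e a) ea.
  transitivity (k ^+ 2 * enorm e ^+ 2 * dot a a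
     + sin (cone_angle K) ^+ 2 * enorm a ^+ 2 * dot e e); first by ring.
  by rewrite sin2cos2 -/k !enorm_sqr; ring.
have y0 : y != 0 by rewrite -dot_gt0 yy mulr_gt0 // dot_gt0.
exists y; last by exists 0; rewrite scale0r addr0.
split => //; apply/angleP => //; rewrite yy /y !dot_lin ea mulr0 addr0.
by rewrite !exprMn enorm_sqr; ring.
Qed.

(** The squared cosine of the half-angle is [s / dot w w]; the bounds on [s] keep the angle strictly
    between 0 and pi / 2. *)
Lemma exists_circular_cone V w (s : R) : 0 < s < dot w w ->
  exists2 K, cone_vertex K = V & cone_points K =
    [set x | dot w (x - V) ^+ 2 = s * dot (x - V) (x - V)].
Proof.
move=> /andP[s0 sw]; have w0 : 0 < dot w w by exact: lt_trans sw.
have wn0 : w != 0 by rewrite -dot_gt0.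
have q0 : 0 < Num.sqrt (s / dot w w) by rewrite sqrtr_gt0 divr_gt0.
have q1 : Num.sqrt (s / dot w w) < 1.
  by rewrite -sqrtr1 ltr_sqrt // ltr_pdivrMr // mul1r.
have qI : Num.sqrt (s / dot w w) \in `[(-1), 1].
  by rewrite in_itv /= (ltW q1) andbT (le_trans _ (ltW q0)) // lerN10.
have angleI : 0 < acos (Num.sqrt (s / dot w w)) < pi / 2.
  rewrite acos_gt0 /=; last by rewrite q1 andbT (le_trans _ (ltW q0)) // lerN10.
  have pi0 := pi_gt0 R.
  rewrite -ltr_cos ?cos_pihalf ?acosK //; rewrite in_itv /=; last by apply/andP; split; lra.
  by rewrite acos_ge0 ?acos_lepi //; move: qI; rewrite in_itv.
exists (CircularCone V wn0 angleI) => //.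
rewrite cone_pointsE /= acosK // sqr_sqrtr ?divr_ge0 ?ltW //.
by rewrite divfK ?gt_eqF.
Qed.

(* The mirror image of [y] in the axis is a point of the cone outside the
   tangent plane along [y]. *)
Lemma cone_mirror w y (s : R) : 0 < s < dot w w -> y != 0 ->
  dot w y ^+ 2 = s * dot y y ->
  let z := (2 * dot w y / dot w w) *: w - y in
  dot w z ^+ 2 = s * dot z z /\ dot w y * dot w z != s * dot y z.
Proof.
move=> /andP[s0 sw] y0 ye; have w0 : dot w w != 0 by rewrite gt_eqF // (lt_trans s0).
have wz : dot w ((2 * dot w y / dot w w) *: w - y) = dot w y.
  by rewrite !dot_lin divfK //; ring.
split; rewrite wz.
  by rewrite ye; congr (_ * _); rewrite !dot_lin (dotC y w); field.
rewrite !dot_lin (dotC y w) -expr2 -subr_eq0.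
have -> : dot w y ^+ 2 - s * (2 * dot w y / dot w w * dot w y - dot y y) =
    2 * (s * dot y y) * (dot w w - s) / dot w w.
  rewrite -ye; transitivity (dot w y ^+ 2 * (1 - 2 * s / dot w w) + s * dot y y).
    by field.
  by rewrite -ye; field.
have yy : dot y y != 0 by rewrite dot_eq0.
have s_neq0 : s != 0 by rewrite gt_eqF.
have ws : dot w w - s != 0 by rewrite subr_eq0 gt_eqF.
by rewrite !mulf_neq0 ?invr_eq0 ?pnatr_eq0.
Qed.

(** Were the vertices distinct, take the mirror image of the second in the axis of [K1]. Both points
    lie on the common cone, and so does their midpoint, since [K2] contains every line joining its
    vertex to one of its points. This makes the two directions conjugate for the quadratic form of
    [K1], against [cone_mirror]. *)
Lemma eq_cone_vertex K1 K2 :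
  cone_points K1 = cone_points K2 -> cone_vertex K1 = cone_vertex K2.
Proof.
move=> K12; apply/esym/eqP; rewrite -subr_eq0; apply: contraT => e0.
have /andP[k0 k1] := circular_cone_cos_bounds K1.
have w0 := cone_axis_neq0 K1; rewrite -dot_gt0 in w0.
set w := cone_axis K1 in w0.
pose s := cos (cone_angle K1) ^+ 2 * dot w w.
have sI : 0 < s < dot w w.
  by rewrite /s mulr_gt0 ?exprn_gt0 //= gtr_pMl // expr_lt1 // ltW.
have K1E x : cone_points K1 x <-> dot w (x - cone_vertex K1) ^+ 2 =
    s * dot (x - cone_vertex K1) (x - cone_vertex K1) by rewrite cone_pointsE.
have V2in : cone_points K1 (cone_vertex K2).
  by rewrite K12 cone_pointsE /= subrr !dot0r mulr0 expr0n.
have [e eE] : exists e, e = cone_vertex K2 - cone_vertex K1 by eexists.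
have /K1E ee := V2in; rewrite -eE in ee e0.
have [z [ze zne]] : exists z, dot w z ^+ 2 = s * dot z z /\
    dot w e * dot w z != s * dot e z by eexists; exact: cone_mirror.
case/negP: zne.
have : cone_points K1 (cone_vertex K1 + z) by apply/K1E; rewrite addrC addKr.
rewrite K12 cone_pointsE /= => zin.
have : cone_points K1 (cone_vertex K1 + 2^-1 *: (e + z)).
  rewrite K12 cone_pointsE /=.
  have -> : cone_vertex K1 + 2^-1 *: (e + z) - cone_vertex K2 =
      2^-1 *: (cone_vertex K1 + z - cone_vertex K2).
    by rewrite eE; apply: row3P; rewrite !mxE; field.
  by rewrite !(dotZl, dotZr) exprMn zin; ring.
move=> /K1E; rewrite addrC addKr !dot_lin (dotC z e) => mid.
have : (dot w e + dot w z) ^+ 2 = s * (dot e e + 2 * dot e z + dot z z).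
  have -> : (dot w e + dot w z) ^+ 2 = 4 * (2^-1 * (dot w e + dot w z)) ^+ 2 by field.
  by rewrite mid; field.
rewrite sqrrD ee ze => mid2; have {}mid2 : 2 * (dot w e * dot w z - s * dot e z) = 0.
  by lra.
by rewrite -subr_eq0; move/eqP: mid2; rewrite mulf_eq0 pnatr_eq0.
Qed.

Lemma tangent_plane_cone V w y (s : R) : 0 < s < dot w w -> y != 0 ->
  dot w y ^+ 2 = s * dot y y ->
  tangent_plane [set x | dot w (x - V) ^+ 2 = s * dot (x - V) (x - V)] (V + y)
  = [set x | dot (dot w y *: w - s *: y) (x - (V + y)) = 0].
Proof.
move=> sI y0 ye; have [z [z1 z2]] : exists z, dot w z ^+ 2 = s * dot z z /\
    dot w y * dot w z != s * dot y z by eexists; exact: cone_mirror.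
(* The secant off the tangent plane runs from [V + y] to its mirror point [V + z]. *)
apply: (@tangent_plane_quadric _ _ _ (z - y) _ w (- s) 1).
- move=> h /=; rewrite -(addrA V) [V + _ - V]addrC addKr !dot_lin (dotC h y) sqrrD ye.
  by split; lra.
- by move: z1 ye; rewrite !dot_lin (dotC z y); lra.
- by apply: contraNneq z2; move: ye; rewrite !dot_lin => ? ?; apply/eqP; lra.
Qed.

Lemma tangent_plane_sphere c x (r : R) : 0 < r -> sphere c r x ->
  tangent_plane (sphere c r) x = [set y | dot (x - c) (y - x) = 0].
Proof.
move=> r0; rewrite sphereE //= => xr.
(* The secant runs from [x] to its antipode. *)
apply: (@tangent_plane_quadric _ _ _ (- (2 *: (x - c))) _ 0 1 0).
- move=> h /=; rewrite addrAC !(dotDl _ h, dotDr _ h) xr (dotC h).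
  by split; lra.
- by rewrite !(dotNl, dotNr, dotZl, dotZr) xr; ring.
- rewrite !(dotNl, dotNr, dotZl, dotZr) xr oppr_eq0.
  by rewrite mulf_neq0 ?pnatr_eq0 // expf_neq0 // gt_eqF.
Qed.

(* The contact point is [U - H]; the first three conditions say that the plane
   orthogonal to [H] is tangent to the unit sphere centred at [U] and to the cone
   with axis [w], the last one that it touches that cone along [U - H]. *)
Lemma exists_contact_normal U w :
  1 < dot U U -> 1 < dot w w ->
  (dot U U - 1) * (dot w w - 1) = (dot U w - 1) ^+ 2 ->
  exists H, [/\ dot H H = 1, dot U H = 1, dot w H = 1 &
    (dot U w - 1) *: w - (dot w w - 1) *: (U - H) = (dot U w - 1) *: H].
Proof.
(* The last condition determines [H] unless [dot U w = dot w w]. That equality forces [U = w], the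
   coaxial case, where any unit [H] with [dot w H = 1] will do. *)
move=> U1 w1 e; have [dN|dN] := eqVneq (dot U w) (dot w w); last first.
  have dN' : dot U w - dot w w != 0 by rewrite subr_eq0.
  pose H := (dot U w - dot w w)^-1 *: ((dot U w - 1) *: w - (dot w w - 1) *: U).
  have UH : dot U H = 1.
    rewrite /H !dot_lin; apply: (mulfI dN'); rewrite mulVKf // mulr1.
    have -> : (dot w w - 1) * dot U U = (dot U w - 1) ^+ 2 + (dot w w - 1) by rewrite -e; ring.
    by ring.
  have wH : dot w H = 1.
    by rewrite /H !dot_lin (dotC w U); field.
  exists H; split => //.
    rewrite {1}/H dotZl dotDl dotNl !dotZl UH wH; apply: (mulfI dN').
    by rewrite mulVKf //; ring.
  have HE : (dot U w - dot w w) *: H = (dot U w - 1) *: w - (dot w w - 1) *: U.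
    by rewrite /H scalerA mulfV // scale1r.
  by rewrite scalerBr opprB addrCA -HE -scalerDl addrC; congr (_ *: _); ring.
have wUU : dot w w = dot U U.
  have w10 : dot w w - 1 != 0 by rewrite subr_eq0 gt_eqF.
  by move: e; rewrite dN expr2 => /(mulIf w10) /addIr.
have wU : U = w.
  apply/eqP; rewrite -subr_eq0 -dot_eq0 !dot_lin (dotC w U) dN -wUU.
  by apply/eqP; ring.
subst U; have w_gt0 : 0 < dot w w := lt_trans ltr01 w1.
have [f f0 fw] := exists_orthogonal w; rewrite dotC in fw.
(* [b] is chosen to make [H] a unit vector. *)
pose b := Num.sqrt ((1 - (dot w w)^-1) / dot f f).
have ff : b ^+ 2 * dot f f = 1 - (dot w w)^-1.
  rewrite sqr_sqrtr ?divfK ?dot_eq0 // divr_ge0 ?dot_ge0 // subr_ge0.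
  by rewrite invf_le1 // ltW.
have wH : dot w ((dot w w)^-1 *: w + b *: f) = 1.
  by rewrite !dot_lin fw mulr0 addr0 mulVf // gt_eqF.
exists ((dot w w)^-1 *: w + b *: f); split => //.
  rewrite dotDl !dotZl wH dotDr !dotZr (dotC f w) fw mulr0 add0r mulr1 mulrA.
  by rewrite -expr2 ff addrC subrK.
by rewrite scalerBr opprB addrCA subrr addr0.
Qed.

(** Passing to [U = e *: u] absorbs the sign. The contact point is [V + (r * e) *: (U - H)], where
    both tangent planes have normal [H]. *)
Lemma cone_tangent_to_sphereP K V w u (r e : R) :
  cone_vertex K = V ->
  cone_points K = [set x | dot w (x - V) ^+ 2
                           = (dot w w - 1) * dot (x - V) (x - V)] ->
  0 < r -> e ^+ 2 = 1 -> 1 < dot u u -> 1 < dot w w ->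
  (dot u u - 1) * (dot w w - 1) = (e * dot u w - 1) ^+ 2 ->
  cone_tangent_to_sphere K (sphere (V + r *: u) r).
Proof.
move=> KV KE r0 e2 u1 w1 ue; have [U UE] : exists U, U = e *: u by eexists.
have UU : dot U U = dot u u by rewrite UE !dot_lin mulrA -expr2 e2 mul1r.
have Uw : dot U w = e * dot u w by rewrite UE dotZl.
rewrite -UU -Uw in u1 ue.
have [H [HH UH wH HE]] := exists_contact_normal u1 w1 ue.
have e0 : e != 0 by rewrite -sqrf_eq0 e2 oner_eq0.
have re0 : r * e != 0 by rewrite mulf_neq0 // gt_eqF.
have d0 : dot U w - 1 != 0.
  by rewrite -sqrf_eq0 -ue mulf_neq0 // subr_eq0 gt_eqF.
pose y := (r * e) *: (U - H).
have wy : dot w y = r * e * (dot U w - 1) by rewrite /y !dot_lin wH (dotC w).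
have yy : dot y y = (r * e) ^+ 2 * (dot U U - 1).
  by rewrite /y !dot_lin (dotC H U) UH HH; ring.
have y0 : y != 0.
  by rewrite -dot_eq0 yy mulf_neq0 ?expf_neq0 // subr_eq0 gt_eqF.
have ye : dot w y ^+ 2 = (dot w w - 1) * dot y y.
  by rewrite wy yy exprMn -ue; ring.
have yc : V + y - (V + r *: u) = (- (r * e)) *: H.
  rewrite /y UE; have -> : r *: u = (r * e ^+ 2) *: u by rewrite e2 mulr1.
  by apply: row3P; rewrite !mxE; ring.
have yS : sphere (V + r *: u) r (V + y).
  by rewrite sphereE //= yc !dot_lin HH mulr1 mulrNN mulrACA -!expr2 e2 mulr1.
have sI : 0 < dot w w - 1 < dot w w by rewrite subr_gt0 w1 /= gtrBl.
exists (V + y); split => //.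
- by rewrite KE /= addrC addKr.
- by move/eqP; rewrite KV -subr_eq0 addrC addKr (negbTE y0).
rewrite KE tangent_plane_cone // tangent_plane_sphere // yc wy.
have -> : (r * e * (dot U w - 1)) *: w - (dot w w - 1) *: y =
    (r * e * (dot U w - 1)) *: H.
  rewrite -[RHS]scalerA -HE [RHS]scalerBr /y !scalerA.
  by congr (_ - _ *: _); ring.
apply/seteqP; split => x /=; rewrite !dotZl => /eqP; rewrite mulf_eq0.
  by rewrite (negbTE (mulf_neq0 re0 d0)) /= => /eqP ->; rewrite mulr0.
by rewrite oppr_eq0 (negbTE re0) /= => /eqP ->; rewrite mulr0.
Qed.
End Cone.

(** * Face planes, their tangent spheres, and the cone at a vertex *)

Section Tetrahedron.
Variable R : realType.
Implicit Types (P X Y Z n c : 'rV[R]_3) (S : set 'rV[R]_3).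

Lemma plane3_rot X Y Z : plane3 X Y Z = plane3 Y Z X.
Proof.
apply/seteqP; split => _ /= [s [t ->]].
  by exists t, (1 - s - t); apply: row3P; rewrite !mxE; ring.
by exists (1 - s - t), s; apply: row3P; rewrite !mxE; ring.
Qed.

Lemma plane3_swap X Y Z : plane3 X Y Z = plane3 X Z Y.
Proof.
by apply/seteqP; split => _ /= [s [t ->]]; exists t, s; apply: row3P; rewrite !mxE; ring.
Qed.

Lemma plane3E P Y Z : cross (Y - P) (Z - P) != 0 ->
  plane3 P Y Z = [set x | dot (cross (Y - P) (Z - P)) (x - P) = 0].
Proof.
set N := cross _ _ => N0; have NN : dot N N != 0 by rewrite dot_eq0.
apply/seteqP; split => x /=.
  by move=> [s [t ->]]; rewrite /N dotE !crossE !mxE; ring.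
(* Cramer's rule with [N] and the two edges: the determinant is [dot N N] and the [N]-coordinate of
   [x - P] vanishes. *)
move=> xN; have := trip_decomp N (Y - P) (Z - P) (x - P).
rewrite /trip -/N (dotC (x - P)) xN scale0r add0r => dec.
exists ((dot N N)^-1 * dot (x - P) (cross (Z - P) N)).
exists ((dot N N)^-1 * dot (x - P) (cross N (Y - P))).
by rewrite -addrA -!scalerA -scalerDr -dec scalerA mulVf // scale1r addrC subrK.
Qed.

(* The tangency point is fixed by the reflection in the normal to the plane
   through the centre, hence it is the foot of that normal. *)
Lemma sphere_tangent_to_planeP P n c (r : R) : dot n n = 1 -> 0 < r ->
  sphere_tangent_to_plane (sphere c r) [set x | dot n (x - P) = 0] ->
  dot n (c - P) ^+ 2 = r ^+ 2.
Proof.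
move=> n1 r0 [x xE]; have : [set x] x by [].
rewrite -{1}xE sphereE // => -[/= xr xP].
have [d dE] : exists d, d = dot n (c - P) by eexists.
have nx : dot n (x - c) = - d by rewrite dE; move: xP; rewrite !dot_lin; lra.
have : [set x] (x - 2 *: (x - c + d *: n)).
  rewrite -xE sphereE //; split => /=.
    have -> : x - 2 *: (x - c + d *: n) - c = - (x - c) - (2 * d) *: n.
      by apply: row3P; rewrite !mxE; ring.
    move: (x - c) xr nx => v vr nv.
    by rewrite !dot_lin (dotC v n) vr nv n1; ring.
  have -> : x - 2 *: (x - c + d *: n) - P = (x - P) - 2 *: (x - c + d *: n).
    by apply: row3P; rewrite !mxE; ring.
  by rewrite dotDr xP dotNr dotZr dotDr nx dotZr n1; ring.
move=> /= /eqP; rewrite -subr_eq0 addrAC subrr add0r oppr_eq0 scaler_eq0.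
rewrite pnatr_eq0 /= addr_eq0 => /eqP xc.
by rewrite -dE -xr xc !dot_lin n1; ring.
Qed.

Lemma plane3_unit_normal P Y Z : cross (Y - P) (Z - P) != 0 ->
  let n := (enorm (cross (Y - P) (Z - P)))^-1 *: cross (Y - P) (Z - P) in
  dot n n = 1 /\ plane3 P Y Z = [set x | dot n (x - P) = 0].
Proof.
move=> N0; have e0 : enorm (cross (Y - P) (Z - P)) != 0 by rewrite gt_eqF // enorm_gt0.
split.
  by rewrite dotZl dotZr -enorm_sqr expr2 mulKf // mulVf.
rewrite plane3E //; apply/seteqP; split => x /=; rewrite dotZl.
  by move=> ->; rewrite mulr0.
by move=> /eqP; rewrite mulf_eq0 invr_eq0 (negbTE e0) => /eqP.
Qed.

Lemma exists_vertex_cone P X Y Z : trip (X - P) (Y - P) (Z - P) != 0 ->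
  exists2 K : circular_cone R, cone_vertex K = P &
    forall S, is_sphere S ->
      sphere_tangent_to_plane S (plane3 P Y Z) ->
      sphere_tangent_to_plane S (plane3 P Z X) ->
      sphere_tangent_to_plane S (plane3 P X Y) -> cone_tangent_to_sphere K S.
Proof.
move=> t0; have cross_neq0 (u v w : 'rV[R]_3) : trip u v w != 0 -> cross v w != 0.
  by apply: contraNneq => e; rewrite /trip e dot0r.
have trip_rot (u v w : 'rV[R]_3) : trip u v w = trip v w u by rewrite !tripE; ring.
have N1 := cross_neq0 _ _ _ t0; rewrite trip_rot in t0.
have N2 := cross_neq0 _ _ _ t0; rewrite trip_rot in t0.
have N3 := cross_neq0 _ _ _ t0; rewrite trip_rot in t0.
have [n11 pl1] := plane3_unit_normal N1.
have [n22 pl2] := plane3_unit_normal N2.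
have [n33 pl3] := plane3_unit_normal N3.
set n1 := _ *: cross (Y - P) (Z - P) in n11 pl1.
set n2 := _ *: cross (Z - P) (X - P) in n22 pl2.
set n3 := _ *: cross (X - P) (Y - P) in n33 pl3.
have tn : trip n1 n2 n3 != 0.
  have enorm_neq0 (v : 'rV[R]_3) : v != 0 -> (enorm v)^-1 != 0.
    by move=> v0; rewrite invr_eq0 gt_eqF // enorm_gt0.
  by rewrite trip_scale trip_cross mulf_neq0 ?expf_neq0 // !mulf_neq0 ?enorm_neq0.
have [w w1 wP] := hart_circle n11 n22 n33 tn.
have sI : 0 < dot w w - 1 < dot w w by rewrite subr_gt0 w1 /= gtrBl.
have [K KV KE] := exists_circular_cone P sI.
exists K => // _ [c [r [r0 ->]]].
rewrite pl1 pl2 pl3 => /sphere_tangent_to_planeP h1.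
move=> /sphere_tangent_to_planeP h2 /sphere_tangent_to_planeP h3.
(* The dilation by [r^-1] centred at [P] reduces to spheres of radius 1. *)
have unit n : dot n (c - P) ^+ 2 = r ^+ 2 ->
    dot n (r^-1 *: (c - P)) ^+ 2 = 1.
  by move=> nc; rewrite dotZr exprMn nc exprVn mulVf // expf_neq0 // gt_eqF.
have [e [e2 u1 ue]] := wP _ (unit _ (h1 n11 r0)) (unit _ (h2 n22 r0))
                            (unit _ (h3 n33 r0)).
have -> : sphere c r = sphere (P + r *: (r^-1 *: (c - P))) r.
  by rewrite scalerA mulfV ?gt_eqF // scale1r addrC subrK.
exact: cone_tangent_to_sphereP KV KE r0 e2 u1 w1 ue.
Qed.

End Tetrahedron.

(** * The cones at the four vertices of the tetrahedron *)

Theorem mainTheorem1 (R : realType) (A B C D : 'rV[R]_3)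
    (hABCD : general_form A B C D) :
  exists K : 'I_4 -> circular_cone R,
    injective (fun i : 'I_4 => cone_points (K i)) /\
    (forall (i : 'I_4) (S : set 'rV[R]_3),
       tangent_spheres A B C D S -> cone_tangent_to_sphere (K i) S).
Proof.
have [/free_trip tA _] := hABCD.
have tB : trip (A - B) (C - B) (D - B) != 0.
  by apply: contra_neq tA; rewrite !tripE !mxE => e; rewrite -[RHS]oppr0 -e; ring.
have tC : trip (A - C) (B - C) (D - C) != 0.
  by apply: contra_neq tA; rewrite !tripE !mxE => <-; ring.
have tD : trip (A - D) (B - D) (C - D) != 0.
  by apply: contra_neq tA; rewrite !tripE !mxE => e; rewrite -[RHS]oppr0 -e; ring.
have [KA vA hA] := exists_vertex_cone tA.
have [KB vB hB] := exists_vertex_cone tB.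
have [KC vC hC] := exists_vertex_cone tC.
have [KD vD hD] := exists_vertex_cone tD.
(* A cone determines its vertex, so distinct vertices give distinct cones. *)
have vertices_uniq : uniq [:: A; B; C; D].
  have trip_neq0 (u v w : 'rV[R]_3) : trip u v w != 0 -> [/\ u != 0, v != 0 & w != 0].
    by move=> t0; split; apply: contra_neq t0 => ->; rewrite tripE !mxE; ring.
  have [] := trip_neq0 _ _ _ tA; have [] := trip_neq0 _ _ _ tB.
  have [] := trip_neq0 _ _ _ tC; rewrite !subr_eq0 => _ _ DC _ CB DB BA CA DA.
  rewrite /= !inE !negb_or (eq_sym A B) (eq_sym A C) (eq_sym A D).
  rewrite (eq_sym B C) (eq_sym B D) (eq_sym C D).
  by rewrite BA CA DA CB DB DC.
exists (fun i => nth KA [:: KA; KB; KC; KD] i); split.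
  move=> i j /eq_cone_vertex.
  have vE (k : 'I_4) : cone_vertex (nth KA [:: KA; KB; KC; KD] k) = nth A [:: A; B; C; D] k.
    by rewrite -(nth_map _ A) //= vA vB vC vD.
  rewrite !vE => /eqP; rewrite nth_uniq // => /eqP; exact: val_inj.
move=> i S [Ssph [SBCD SACD SABD SABC]].
case: i => -[|[|[|[|//]]]] /= _.
- by apply: hA => //; rewrite plane3_swap.
- apply: hB => //; first by rewrite -plane3_rot.
  by rewrite plane3_swap -plane3_rot.
- apply: hC => //; last by rewrite -2!plane3_rot.
    by rewrite plane3_swap -plane3_rot.
  by rewrite -plane3_rot.
- apply: hD => //.
  + by rewrite -plane3_rot -plane3_rot.
  + by rewrite plane3_swap -plane3_rot -plane3_rot.
  + by rewrite -plane3_rot -plane3_rot.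
Qed.
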